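(* Let $X$ be a real Banach space, let $f\in\Gamma(X)$, and let $\bar x\in X$ and $\bar y^*\in X^*$ be such that $\bar y^*\in\partial f(\bar x)$. The following assertions are equivalent. (i) The set-valued mapping $\partial f$ is strongly subregular at $\bar x$ for $\bar y^*$. (ii) There exist a neighborhood $U$ of $\bar x$ and a positive constant $c$ such that $$f(x)\geq f(\bar x)+\langle \bar y^*,x-\bar x\rangle +c\|x-\bar x\|^2\quad \text{whenever } x\in U.$$ (iii) There exist a neighborhood $U$ of $\bar x$ and a positive constant $c$ such that $$\langle y^*-\bar y^*,x-\bar x\rangle \geq c\|x-\bar x\|^2\quad\text{for all } x \in U \text{ and } y^*\in \partial f(x).$$ (iv) The point $(\bar x,\bar y^* )$ is locally strongly monotonically related to $\operatorname{gph}(\partial f)$.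
   Context: $X^*$ is the dual of $X$. $\Gamma(X)$ is the set of all proper (i.e. with nonempty domain), lower semicontinuous, convex functions $f:X\to\mathbb{R}\cup\{\infty\}$; $\operatorname{dom} f=\{x: f(x)<\infty\}$. The subdifferential is the set-valued mapping $\partial f:X\rightrightarrows X^*$, $\partial f(x)=\{y^*\in X^*: f(z)\geq f(x)+\langle y^*,z-x\rangle \text{ for all } z\in X\}$ for $x\in\operatorname{dom} f$, and $\partial f(x)=\emptyset$ otherwise. For a set-valued mapping $F$, $\operatorname{gph}F=\{(x,y): y\in F(x)\}$. The distance is $d(x,C)=\inf_{y\in C}\|x-y\|$, with $d(x,\emptyset)=\infty$. A set-valued mapping $F:X\rightrightarrows Y$ between Banach spaces is strongly (metrically) subregular at $\bar x$ for $\bar y$ if $\bar y\in F(\bar x)$ and there are $\kappa>0$ and neighborhoods $U$ of $\bar x$ and $V$ of $\bar y$ such that $\|x-\bar x\|\leq\kappa\, d(\bar y,F(x)\cap V)$ for all $x\in U$. Given $T:X\rightrightarrows X^*$, a point $(\bar x,\bar y^* )\in\operatorname{gph}T$ is (locally) strongly monotonically related to $\operatorname{gph} T$ if there are neighborhoods $U$ of $\bar x$ and $V$ of $\bar y^*$ and a constant $c>0$ such that $\langle y^*-\bar y^*,x-\bar x\rangle\geq c\|x-\bar x\|^2$ for all $(x,y^* )\in\operatorname{gph} T\cap(U\times V)$. *)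

(* Defs.v *)
From HB Require Import structures.
From mathcomp Require Import all_boot all_order all_algebra.
From mathcomp Require Import all_classical all_reals all_analysis.
Set Implicit Arguments.
Unset Strict Implicit.
Unset Printing Implicit Defensive.
Import Order.TTheory GRing.Theory Num.Theory.
Import numFieldNormedType.Exports.
Local Open Scope classical_set_scope.
Local Open Scope ring_scope.

(** The topological dual of a normed space, as a normed space. *)
Section dual.
Context {R : realType} (X : normedModType R).
Implicit Types f g : X -> R^o.

Definition continuous_linear : {pred X -> R^o} :=
  fun f => `[< linear f /\ continuous f >].

Lemma continuous_linear_submod : submod_closed continuous_linear.
Proof.
split; first by apply/asboolP; split=> [a u v|x] /=;
  [rewrite /GRing.zero /= scaler0 addr0 | exact: cvg_cst].
move=> a f g /asboolP[lf cf] /asboolP[lg cg]; apply/asboolP; split.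
- move=> b u v; rewrite !fctE lf lg !scalerDr !scalerA (mulrC a b).
  by rewrite addrACA.
- move=> x; apply: cvgD; last exact: cg.
  by apply: cvgZl_tmp; exact: cf.
Qed.

HB.instance Definition _ :=
  GRing.isSubmodClosed.Build R (X -> R^o) continuous_linear
    continuous_linear_submod.

Record dual := Dual {
  dual_fun :> X -> R^o;
  dual_funP : dual_fun \in continuous_linear }.

HB.instance Definition _ := [isSub for dual_fun].
HB.instance Definition _ := [Choice of dual by <:].
HB.instance Definition _ := [SubChoice_isSubLmodule of dual by <:].

Implicit Types (y : dual) (u v : X).

Lemma dual_linear y : linear y.
Proof. by have /asboolP[] := dual_funP y. Qed.

Lemma dual_continuous y : continuous y.
Proof. by have /asboolP[] := dual_funP y. Qed.

HB.instance Definition _ y :=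
  GRing.isLinear.Build R X R^o *:%R y (dual_linear y).

Lemma dual_addE (y1 y2 : dual) u : (y1 + y2) u = y1 u + y2 u.
Proof. by []. Qed.

Lemma dual_scaleE (a : R) y u : (a *: y) u = a * y u.
Proof. by []. Qed.

Lemma dual_oppE y u : (- y) u = - y u.
Proof. by []. Qed.

Definition dual_norm y : R := sup [set `|y u| | u in [set u | `|u| <= 1]].

Lemma dual_norm_has_sup y : has_sup [set `|y u| | u in [set u | `|u| <= 1]].
Proof.
split; first by exists `|y 0|, 0 => //=; rewrite normr0.
have /linear_bounded_continuous/bounded_funP/(_ 1)[M yM] := @dual_continuous y.
by exists M => _ [u /= u1 <-]; exact: yM.
Qed.

Lemma dual_norm_ub y u : `|u| <= 1 -> `|y u| <= dual_norm y.
Proof. by move=> u1; apply: ub_le_sup (dual_norm_has_sup y).2 _ _; exists u. Qed.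

Lemma dual_norm_le y (M : R) :
  (forall u, `|u| <= 1 -> `|y u| <= M) -> dual_norm y <= M.
Proof.
move=> yM; apply: ge_sup (dual_norm_has_sup y).1 _.
by move=> _ [u /= u1 <-]; exact: yM.
Qed.

Lemma dual_norm_ge0 y : 0 <= dual_norm y.
Proof. by apply: le_trans (@dual_norm_ub y 0 _); rewrite ?normr0. Qed.

Lemma dual_norm_bound y u : `|y u| <= dual_norm y * `|u|.
Proof.
have [->|u0] := eqVneq u 0; first by rewrite linear0 !normr0 mulr0.
have nu : 0 < `|u| by rewrite normr_gt0.
have := @dual_norm_ub y (`|u|^-1 *: u).
rewrite normrZ normfV normr_id mulVf ?gt_eqF// => /(_ (lexx _)).
rewrite linearZ /= normrM normfV normr_id mulrC.
by rewrite ler_pdivrMr.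
Qed.

Let dual_ler_normD y1 y2 : dual_norm (y1 + y2) <= dual_norm y1 + dual_norm y2.
Proof.
apply: dual_norm_le => u u1; rewrite dual_addE (le_trans (ler_normD _ _))//.
by rewrite lerD ?dual_norm_ub.
Qed.

Let dual_normrZ (a : R) y : dual_norm (a *: y) = `|a| * dual_norm y.
Proof.
have le (b : R) z : dual_norm (b *: z) <= `|b| * dual_norm z.
  apply: dual_norm_le => u u1.
  by rewrite dual_scaleE normrM ler_wpM2l ?dual_norm_ub.
have [->|a0] := eqVneq a 0.
  by apply: le_anti; rewrite le normr0 mul0r dual_norm_ge0.
apply: le_anti; rewrite le /= mulrC -ler_pdivlMr ?normr_gt0// mulrC -normfV.
by rewrite -{1}[y](scalerK a0) le.
Qed.

Let dual_norm_eq0 y : dual_norm y = 0 -> y = 0.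
Proof.
move=> y0; apply/val_inj/funext => u /=.
by apply/normr0_eq0/le_anti; rewrite normr_ge0 (le_trans (dual_norm_bound y u))// y0 mul0r.
Qed.

HB.instance Definition _ :=
  Lmodule_isNormed.Build R dual dual_ler_normD dual_normrZ dual_norm_eq0.

Lemma dual_normE y :
  `|y| = sup [set `|y u| | u in [set u | `|u| <= 1]].
Proof. by []. Qed.

End dual.

Section Gamma.
Context {R : realType} (X : normedModType R).
Local Open Scope ereal_scope.

(* t = 0 and t = 1 are trivial; leaving them out avoids the products 0 * +oo *)
Definition convex_efun (f : X -> \bar R) := forall (x z : X) (t : R),
  (0 < t < 1)%R ->
  f (t *: x + (1 - t) *: z)%R <= t%:E * f x + (1 - t)%:E * f z.

Definition Gamma : set (X -> \bar R) := [set f |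
  [/\ forall x, f x != -oo, exists x, f x < +oo,
      lower_semicontinuous f & convex_efun f]].

End Gamma.

Section set_valued.
Context {R : realType}.

Definition gph (X Y : Type) (F : X -> set Y) : set (X * Y) :=
  [set p | F p.1 p.2].

(* the infimum of the empty set in [\bar R] is +oo *)
Definition distance (Y : normedModType R) (y : Y) (C : set Y) : \bar R :=
  ereal_inf [set `|y - z|%:E | z in C].

Definition subdifferential (X : normedModType R) (f : X -> \bar R) (x : X) :
    set (dual X) :=
  [set y | f x < +oo /\ forall z, f x + (y (z - x))%:E <= f z]%E.

Definition strongly_subregular (X Y : normedModType R) (F : X -> set Y)
    (xb : X) (yb : Y) :=
  F xb yb /\
  exists kappa : R, 0 < kappa /\
  exists U V, [/\ nbhs xb U, nbhs yb V &
    forall x, U x ->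
      (`|x - xb|%:E <= kappa%:E * distance yb (F x `&` V))%E].

Definition strongly_monotonically_related (X : normedModType R)
    (T : X -> set (dual X)) (xb : X) (yb : dual X) :=
  gph T (xb, yb) /\
  exists U V, [/\ nbhs xb U, nbhs yb V &
    exists c : R, 0 < c /\
    forall x y, (gph T `&` (U `*` V)) (x, y) ->
      c * `|x - xb| ^+ 2 <= (y - yb) (x - xb)].

End set_valued.

(* Main.v *)
(* The hard implication is (i) -> (ii). If the quadratic growth in (ii) failed
   with [c = 1 / (8 kappa)] at some [z] near [xb], with [r = |z - xb|], then
   Ekeland's principle applied to [f - yb] would give an [x] within [r / 2] of
   [z] minimizing [f - yb + 2 c r |. - x|]. The sum rule turns this into a
   subgradient [y] of [f] at [x] with [|y - yb| <= 2 c r], and subregularity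
   gives [|x - xb| <= 2 kappa c r = r / 4], contradicting [|x - xb| >= r / 2]. *)
Require Import Defs.
From HB Require Import structures.
From mathcomp Require Import all_boot all_order all_algebra.
From mathcomp Require Import all_classical all_reals all_analysis.
From mathcomp Require Import ring lra.
Set Implicit Arguments.
Unset Strict Implicit.
Unset Printing Implicit Defensive.
Import Order.TTheory GRing.Theory Num.Theory.
Import numFieldNormedType.Exports.
Local Open Scope classical_set_scope.
Local Open Scope ring_scope.

(** * Sublinear functionals and a Hahn-Banach sandwich theorem *)

Section sublinear.
Context {R : realType} {V : lmodType R}.
Implicit Types (p q : V -> R) (u v w : V) (K : set (V * R)).

Definition sublinear p :=
  (forall u v, p (u + v) <= p u + p v) /\
  (forall t u, 0 < t -> p (t *: u) <= t * p u).

(** A pair [(w, r)] of the cone encodes the constraint [y w <= r] on a linear [y]. *)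
Definition convex_cone K :=
  [/\ K (0, 0),
      forall k l, K k -> K l -> K (k.1 + l.1, k.2 + l.2) &
      forall t k, 0 < t -> K k -> K (t *: k.1, t * k.2)].

Lemma sublinear0 p : sublinear p -> p 0 = 0.
Proof.
move=> [pD pZ]; have := pD 0 0; rewrite addr0 => p0.
have := pZ 2^-1 0; rewrite invr_gt0 ltr0n scaler0 => /(_ isT) p0'.
by apply/le_anti/andP; split; lra.
Qed.

Lemma sublinearZ p t u : sublinear p -> 0 <= t -> p (t *: u) = t * p u.
Proof.
move=> sp; rewrite le_eqVlt => /predU1P[<-|t0].
  by rewrite scale0r mul0r sublinear0.
apply/le_anti; rewrite sp.2//= mulrC -ler_pdivlMr// mulrC.
by rewrite -{1}[u](scalerK (lt0r_neq0 t0)) sp.2// invr_gt0.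
Qed.

Lemma sublinearN p u : sublinear p -> - p (- u) <= p u.
Proof.
by move=> sp; rewrite lerNl -subr_ge0 opprK -(sublinear0 sp) -(addNr u) sp.1.
Qed.

(** [sublinearN] supplies the other half of oddness, and oddness turns subadditivity into
    additivity. *)
Lemma sublinear_linear p :
  sublinear p -> (forall u, p (- u) <= - p u) -> linear (p : V -> R^o).
Proof.
move=> sp pN.
have {}pN u : p (- u) = - p u.
  by apply/le_anti; rewrite pN/= lerNl sublinearN.
have pD u v : p (u + v) = p u + p v.
  apply/le_anti; rewrite sp.1/=.
  by rewrite -lerN2 opprD -!pN opprD sp.1.
move=> t u v; rewrite pD; congr (_ + _).
have [t0|/ltW t0] := leP 0 t; first exact: sublinearZ.
by rewrite -[t]opprK scaleNr pN sublinearZ ?oppr_ge0// -mulNr.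
Qed.

(* The largest sublinear minorant of [p] lying below [r] at [w] for every
   [(w, r)] in the cone [K]. *)
Definition cone_inf p K v : R := inf [set k.2 + p (v - k.1) | k in K].

Section cone_inf.
Variables (p : V -> R) (K : set (V * R)).
Hypotheses (sp : sublinear p) (cK : convex_cone K).
(** Compatibility of the constraints with [p]: a linear [y <= p] with [y w <= r] has
    [0 = y w + y (- w) <= r + p (- w)]. It also keeps the infimum finite. *)
Hypothesis pK : forall k, K k -> 0 <= k.2 + p (- k.1).

Lemma cone_inf_has_inf v : has_inf [set k.2 + p (v - k.1) | k in K].
Proof.
split; first by case: cK => K0 _ _; exists (0 + p (v - 0)), (0, 0).
exists (- p (- v)) => _ [k /pK k0 <-].
by have := sp.1 (v - k.1) (- v); rewrite addrAC subrr sub0r; lra.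
Qed.

Lemma cone_inf_le v k : K k -> cone_inf p K v <= k.2 + p (v - k.1).
Proof. by move=> Kk; apply: (ge_inf (cone_inf_has_inf v).2); exists k. Qed.

Lemma cone_inf_leP v e : 0 < e ->
  exists2 k, K k & k.2 + p (v - k.1) < cone_inf p K v + e.
Proof.
by move=> /(inf_adherent)/(_ (cone_inf_has_inf v))[_ [k Kk <-]]; exists k.
Qed.

(** Near-optimal cone points for [u] and [v] add up to a competitor for [u + v], and they scale
    along with [u]. *)
Lemma cone_inf_sublinear : sublinear (cone_inf p K).
Proof.
case: (cK) => _ KD KZ; split=> [u v|t u t0].
  apply/ler_addgt0Pr => e e0; have e20 : 0 < e / 2 by lra.
  have [k Kk ku] := cone_inf_leP u e20.
  have [l Kl lv] := cone_inf_leP v e20.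
  apply: le_trans (cone_inf_le _ (KD _ _ Kk Kl)) _ => /=.
  by have := sp.1 (u - k.1) (v - l.1); rewrite addrACA -opprD; lra.
rewrite mulrC -ler_pdivrMr//; apply/ler_addgt0Pr => e /(cone_inf_leP u)[k Kk].
move=> /ltW; apply: le_trans; rewrite ler_pdivrMr// mulrC mulrDr.
apply: le_trans (cone_inf_le _ (KZ _ _ t0 Kk)) _ => /=.
by rewrite -scalerBr lerD2l sp.2.
Qed.

Lemma cone_inf_le_sublinear v : cone_inf p K v <= p v.
Proof.
by case: cK => K0 _ _; have := cone_inf_le v K0; rewrite /= add0r subr0.
Qed.

Lemma cone_inf_le_cone k : K k -> cone_inf p K k.1 <= k.2.
Proof. by move=> /(cone_inf_le k.1); rewrite subrr sublinear0// addr0. Qed.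

End cone_inf.

(** The pointwise infimum is bounded below by [- q (- v)]. For subadditivity, near-minimizers at [u]
    and at [v] are comparable, so the smaller one serves at both points. *)
Lemma sublinear_inf_chain q (A : set (V -> R)) :
  A !=set0 -> (forall p, A p -> sublinear p) ->
  (forall p v, A p -> p v <= q v) ->
  total_on A (fun p p' => forall v, p' v <= p v) ->
  exists2 p0, sublinear p0 & forall p v, A p -> p0 v <= p v.
Proof.
move=> [p1 Ap1] sA qA tA.
have hi v : has_inf [set p v | p in A].
  split; first by exists (p1 v), p1.
  exists (- q (- v)) => _ [p Ap <-].
  by apply: le_trans (sublinearN _ (sA _ Ap)); rewrite lerN2 qA.
pose p0 v := inf [set p v | p in A].
have p0le p v : A p -> p0 v <= p v.
  by move=> Ap; apply: (ge_inf (hi v).2); exists p.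
have p0adh v e : 0 < e -> exists2 p, A p & p v < p0 v + e.
  by move=> /inf_adherent/(_ (hi v))[_ [p Ap <-]]; exists p.
exists p0 => //; split=> [u v|t u t0].
  apply/ler_addgt0Pr => e e0; have e20 : 0 < e / 2 by lra.
  have [p Ap pu] := p0adh u _ e20; have [p' Ap' pv] := p0adh v _ e20.
  have [pp'|pp'] := tA _ _ Ap Ap'.
  - apply: le_trans (p0le _ _ Ap') _.
    by have := (sA _ Ap').1 u v; have := pp' u; lra.
  - apply: le_trans (p0le _ _ Ap) _.
    by have := (sA _ Ap).1 u v; have := pp' v; lra.
rewrite mulrC -ler_pdivrMr//; apply/ler_addgt0Pr => e /(p0adh u)[p Ap].
move=> /ltW; apply: le_trans; rewrite ler_pdivrMr// mulrC.
by apply: le_trans (p0le _ _ Ap) _; rewrite (sA _ Ap).2.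
Qed.

Lemma exists_minimal_sublinear q : sublinear q ->
  exists p, [/\ sublinear p, forall v, p v <= q v &
    forall p', sublinear p' -> (forall v, p' v <= p v) -> p' = p].
Proof.
move=> sq.
pose T := {p : V -> R | sublinear p /\ forall v, p v <= q v}.
(* The order is reversed, so that Zorn's maximal element is a minimal functional. *)
pose below (s t : T) := `[< forall v, sval t v <= sval s v >].
have [|||A tA|[p [sp pq]] pmin] := @Zorn T below.
- by move=> s; apply/asboolP.
- move=> r s t /asboolP rs /asboolP st; apply/asboolP => v.
  exact: le_trans (st v) (rs v).
- move=> [s Hs] [t Ht] /asboolP/= st /asboolP/= ts; apply: eq_exist.
  by apply/funext => v; apply/le_anti; rewrite st ts.
- have [->|/set0P[s0 As0]] := eqVneq A set0.
    by exists (exist _ q (conj sq (fun v => lexx _))).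
  have [|p|p v|s t|p0 sp0 p0A] := @sublinear_inf_chain q [set sval s | s in A].
  - by exists (sval s0), s0.
  - by move=> [s _ <-]; exact: (svalP s).1.
  - by move=> [s _ <-]; exact: (svalP s).2.
  - move=> [{}s As <-] [{}t At <-].
    by have [/asboolP|/asboolP] := tA _ _ As At; [left|right].
  have p0q v : p0 v <= q v.
    by apply: le_trans (p0A (sval s0) v _) ((svalP s0).2 v); exists s0.
  exists (exist _ p0 (conj sp0 p0q)) => s As; apply/asboolP => v /=.
  by apply: p0A; exists s.
exists p; split=> // p' sp' p'p.
have Hp' : sublinear p' /\ forall v, p' v <= q v.
  by split=> // v; exact: le_trans (p'p v) (pq v).
have := pmin (exist _ p' Hp'); rewrite /below/= => /(_ _)/(congr1 sval)/=.
by apply; apply/asboolP.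
Qed.

(* Sandwich form of the Hahn-Banach theorem: a minimal sublinear function [p0]
   below [cone_inf p K] is linear, because minimality makes it equal to its own
   [cone_inf] along the ray [{(- t u, - t p0(u)) | t >= 0}], for every [u]. *)
Lemma hahn_banach_cone p K : sublinear p -> convex_cone K ->
  (forall k, K k -> 0 <= k.2 + p (- k.1)) ->
  exists y : {linear V -> R^o}, (forall v, y v <= p v) /\
    forall k, K k -> y k.1 <= k.2.
Proof.
move=> sp cK pK.
have [p0 [sp0 p0q p0min]] := exists_minimal_sublinear (cone_inf_sublinear sp cK pK).
have p0l : linear (p0 : V -> R^o).
  apply: sublinear_linear => // u.
  pose L := [set (- (t *: u), - (t * p0 u)) | t in [set t : R | 0 <= t]].
  have cL : convex_cone L.
    split=> [|_ _ [s /= s0 <-] [t /= t0 <-]|t _ t0 [s /= s0 <-]].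
    + by exists 0; rewrite //= scale0r mul0r !oppr0.
    + by exists (s + t); rewrite /= ?addr_ge0// scalerDl mulrDl !opprD.
    + by exists (t * s); rewrite /= ?mulr_ge0// ?ltW// scalerN scalerA mulrN mulrA.
  have pL k : L k -> 0 <= k.2 + p0 (- k.1).
    by move=> [t /= t0 <-] /=; rewrite opprK sublinearZ// addNr.
  have L1 : L (- u, - p0 u) by exists 1; rewrite //= scale1r mul1r.
  have p0L : cone_inf p0 L = p0.
    apply: p0min; first exact: cone_inf_sublinear.
    by move=> v; exact: cone_inf_le_sublinear.
  (* The ray's point at [t = 1] gives [p0 (- u) <= - p0 u]. *)
  by rewrite -{1}p0L; exact: (cone_inf_le_cone sp0 cL pL L1).
pose y : {linear V -> R^o} := HB.pack p0 (GRing.isLinear.Build R V R^o *:%R p0 p0l).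
exists y; split=> [v|k Kk].
- by apply: le_trans (p0q v) _; exact: cone_inf_le_sublinear.
- by apply: le_trans (p0q k.1) _; exact: cone_inf_le_cone.
Qed.

End sublinear.

(** * Ekeland's variational principle *)

Section ekeland.
Context {R : realType}.
Local Open Scope ereal_scope.

Lemma lower_semicontinuousD (T : topologicalType) (f : T -> \bar R)
    (h : T -> R) : lower_semicontinuous f -> continuous h ->
  lower_semicontinuous (fun x => f x + (h x)%:E).
Proof.
move=> lf ch x a afh.
(* With [b] strictly between [a - h x] and [f x], both [f > b] and [h > a - b] hold near [x]. *)
have [b abh bf] : exists2 b, (a - h x < b)%R & b%:E < f x.
  move: afh; case: (f x) => [r| |]//.
    rewrite -EFinD lte_fin => ar; exists ((a - h x + r) / 2)%R; first lra.
    by rewrite lte_fin; lra.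
  by move=> _; exists (a - h x + 1)%R; [lra|rewrite ltry].
have [U xU Ubf] := lf x b bf.
exists (U `&` [set u | (a - b < h u)%R]).
  apply: filterI => //.
  by apply: (cvgr_gt _ (ch x)); lra.
move=> y [/Ubf bfy /= abhy].
have /lteD/(_ bfy) : (a - b)%:E < (h y)%:E by rewrite lte_fin.
by rewrite -EFinD subrK addeC.
Qed.

(* Zorn's lemma for the order [u <= x] iff [g u + a |u - x| <= g x]: along a
   chain [g] decreases to its infimum, so the chain is a Cauchy filter. *)
Lemma ekeland (X : completeNormedModType R) (g : X -> \bar R) (a m : R) (z : X) :
  (0 < a)%R -> lower_semicontinuous g -> (forall x, m%:E <= g x) ->
  g z < +oo ->
  exists x, g x + (a * `|x - z|)%:E <= g z /\
    forall u, g x <= g u + (a * `|u - x|)%:E.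
Proof.
move=> a0 lg mg gz.
pose S x := [set u | g u + (a * `|u - x|)%:E <= g x].
have Sxx x : S x x by rewrite /S/= subrr normr0 mulr0 adde0.
have Strans x y u : S x y -> S y u -> S x u.
  rewrite /S/= => xy yu; apply: le_trans xy; apply: le_trans (leeD2r _ yu).
  rewrite -addeA leeD2l// -EFinD lee_fin -mulrDr ler_pM2l//.
  exact: ler_distD.
have Sle x u : S x u -> g u <= g x.
  by apply: le_trans; rewrite leeDl// lee_fin mulr_ge0// ltW.
have gfin u : S z u -> g u \is a fin_num.
  move=> /Sle gu; rewrite fin_numElt (lt_le_trans _ (mg u)) ?ltNyr//=.
  exact: le_lt_trans gu gz.
have Sclosed x : closed (S x).
  (* For finite [g x] this is a sublevel set of a lower semicontinuous function; otherwise
     [g x = +oo] and [S x] is the whole space. *)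
  rewrite -openC; have [gx|gx] := boolP (g x \is a fin_num); last first.
    have -> : ~` S x = set0; last exact: open0.
    apply/seteqP; split=> u //=; apply; rewrite /S/=.
    by move: gx (mg x); case: (g x) => // _ _; exact: leey.
  have /lower_semicontinuousP/(_ (fine (g x))) :
      lower_semicontinuous (fun u => g u + (a * `|u - x|)%:E).
    apply: lower_semicontinuousD => // u.
    apply: cvgM; first exact: cvg_cst.
    by apply: cvg_norm; apply: cvgB; [exact: cvg_id|exact: cvg_cst].
  congr open; apply/seteqP; split=> u /=; rewrite /S/= fineK//.
    by rewrite ltNge => /negP.
  by move=> /negP; rewrite -ltNge.
pose T := {u : X | S z u}.
pose le (s t : T) := `[< S (sval s) (sval t) >].
pose h (s : T) := fine (g (sval s)).
have hE s : g (sval s) = (h s)%:E by rewrite fineK// gfin//; exact: svalP.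
have leE s t : le s t -> (a * `|sval t - sval s| <= h s - h t)%R.
  by move=> /asboolP; rewrite /S/= !hE -EFinD lee_fin; lra.
have [|||A tA|[x zx] xmax] := @Zorn T le.
- by move=> s; apply/asboolP; exact: Sxx.
- move=> r s t /asboolP rs /asboolP st; apply/asboolP; exact: Strans rs st.
- move=> s t st ts; have := leE _ _ st; have := leE _ _ ts.
  rewrite distrC => l1 l2.
  have /eqP : (`|sval t - sval s| = 0)%R.
    by apply/le_anti; rewrite normr_ge0 andbT -(ler_pM2l a0) mulr0; lra.
  rewrite normr_eq0 subr_eq0 => /eqP; case: s t {st ts l1 l2} => [s Hs] [t Ht] /= ts.
  exact/esym/eq_exist.
- have [->|/set0P[s0 As0]] := eqVneq A set0; first by exists (exist _ z (Sxx z)).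
  (* The tails of the chain form a filter base. *)
  pose B (s : T) := [set u : X | exists t, [/\ A t, le s t & u = sval t]].
  pose F := filter_from A B.
  have FF : ProperFilter F.
    apply: filter_from_proper; last first.
      by move=> s As; exists (sval s), s; split => //; apply/asboolP.
    apply: filter_from_filter; first by exists s0.
    move=> s t As At.
    have le3 r r' : le r r' -> B r' `<=` B r.
      move=> /asboolP rr' _ [r'' [Ar'' /asboolP r'r'' ->]].
      by exists r''; split=> //; apply/asboolP; exact: Strans rr' r'r''.
    have [st|ts] := tA s t As At.
      by exists t => // u tu; split=> //; exact: le3 st _ tu.
    by exists s => // u su; split=> //; exact: le3 ts _ su.
  have hA : has_inf [set h s | s in A].
    split; first by exists (h s0), s0.
    by exists m => _ [s _ <-]; rewrite -lee_fin -hE mg.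
  have /cauchy_cvg cF : cauchy F.
    apply: cauchy_exP => e e0.
    (* Once [h s] is within [a * e] of its infimum, [leE] puts all later points of the chain within
       [e] of [s]. *)
    have [_ [s As <-] sinf] := inf_adherent (mulr_gt0 a0 e0) hA.
    exists (sval s), s => // _ [t [At st ->]].
    rewrite -ball_normE /ball_/= distrC -(ltr_pM2l a0).
    apply: le_lt_trans (leE _ _ st) _.
    by have := ge_inf hA.2 (imageP h At); lra.
  have lS s : A s -> S (sval s) (lim F).
    move=> As; apply: (@closed_cvg _ _ F FF id _ (Sclosed (sval s))) => //.
    by exists s => // _ [t [_ /asboolP st ->]].
  have zl : S z (lim F) by apply: Strans (lS s0 As0); exact: svalP.
  by exists (exist _ _ zl) => s As; apply/asboolP; exact: lS.
(* A violating [u] would lie above [x] in the order, so [u = x] by maximality, and the strict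
   inequality fails. *)
exists x; split=> // u; rewrite leNgt; apply/negP => gu.
have Sxu : S x u by exact: ltW.
have := xmax (exist _ u (Strans _ _ _ zx Sxu)) => /(_ _)/(congr1 sval)/= ux.
by move: gu; rewrite ux ?subrr ?normr0 ?mulr0 ?adde0 ?ltxx//; apply/asboolP.
Qed.

End ekeland.

(** * Subgradients at perturbed minima *)

Section subgradient.
Context {R : realType} {X : normedModType R}.

Lemma dual_of_bounded_linear (y : {linear X -> R^o}) (M : R) :
  (forall v, `|y v| <= M * `|v|) -> exists y' : dual X, y' =1 y.
Proof.
move=> yM.
have cy : continuous y.
  apply/linear_bounded_continuous/bounded_funP => r.
  exists (`|M| * r) => v vr; apply: le_trans (yM v) _.
  apply: le_trans (ler_wpM2r _ (ler_norm M)) _ => //.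
  by rewrite ler_wpM2l.
have yP : (y : X -> R^o) \in @continuous_linear R X.
  by apply/asboolP; split=> //; exact: linearP.
by exists (Dual yP).
Qed.

(* The inequality says that [f - yb] attains a minimum at [x] up to the
   perturbation [a |u - x|], so the conclusion is the sum rule for
   [f + a |. - x|]. It is the sandwich theorem for [v |-> yb v + a |v|] and the
   cone spanned by the epigraph of [w |-> f (x + w) - f x]. *)
Lemma perturbed_minimum_subgradient (f : X -> \bar R) (yb : dual X) (x : X)
    (a : R) : convex_efun f -> f x \is a fin_num -> 0 <= a ->
  (forall u, f x + (yb (u - x)%R)%:E <= f u + (a * `|u - x|)%:E)%E ->
  exists2 y : dual X, subdifferential f x y & `|y - yb| <= a.
Proof.
move=> cf fx a0 fmin.
pose h := fine (f x); have hE : f x = h%:E by rewrite fineK.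
pose epi := [set k : X * R | (f (x + k.1)%R <= (h + k.2)%:E)%E].
pose K := [set (tk.1 *: tk.2.1, tk.1 * tk.2.2) | tk in
  [set tk : R * (X * R) | 0 < tk.1 /\ epi tk.2]].
pose p (v : X) : R := yb v + a * `|v|.
have sp : sublinear p.
  split=> [u v|t u t0]; rewrite /p.
    rewrite linearD /= addrACA lerD2l -mulrDr.
    by rewrite ler_wpM2l// ler_normD.
  by rewrite linearZ/= normrZ gtr0_norm// mulrDr mulrCA.
have cK : convex_cone K.
  split=> [|_ _ [[s [w r]]/= [s0 wr] <-] [[t [w' r']]/= [t0 wr'] <-]
    |s _ s0 [[t k]/= [t0 ek] <-]].
  - exists (1, (0, 0)); rewrite /= ?scaler0 ?mulr0//; split => //.
    by rewrite /epi/= !addr0 hE.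
  - have st0 : 0 < s + t by rewrite addr_gt0.
    (* The sum of [s (w, r)] and [t (w', r')] is [s + t] times their convex combination with weight
       [c = s / (s + t)]. *)
    have [c c01 sc] : exists2 c, 0 < c < 1 & (s + t) * c = s.
      exists (s / (s + t)); last by rewrite mulrC divfK// gt_eqF.
      by rewrite divr_gt0//= ltr_pdivrMr// mul1r ltrDl.
    have tc : (s + t) * (1 - c) = t by rewrite mulrBr sc; ring.
    exists (s + t, (c *: w + (1 - c) *: w', c * r + (1 - c) * r')) => /=.
      split=> //; rewrite /epi/=.
      have -> : x + (c *: w + (1 - c) *: w') =
          c *: (x + w) + (1 - c) *: (x + w').
        rewrite !scalerDr addrACA -scalerDl.
        by rewrite (_ : c + (1 - c) = 1) ?scale1r//; ring.
      have /andP[c0 c1] := c01.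
      apply: le_trans (cf _ _ _ c01) _.
      have -> : h + (c * r + (1 - c) * r') = c * (h + r) + (1 - c) * (h + r').
        by ring.
      rewrite [leRHS]EFinD !(EFinM _ (h + _)).
      apply: leeD; apply: lee_wpmul2l => //; rewrite lee_fin ?subr_ge0; exact: ltW.
    by rewrite scalerDr !scalerA sc tc mulrDr !mulrA sc tc.
  - exists (s * t, k); rewrite /= ?scalerA ?mulrA//; split=> //.
    exact: mulr_gt0.
(* Up to the factor [t], this is [fmin] at [x + w] combined with the epigraph inequality. *)
have pK k : K k -> 0 <= k.2 + p (- k.1).
  move=> [[t [w r]]/= [t0 wr] <-] /=.
  rewrite /p linearN linearZ /= -[t *: yb w]/(t * yb w) normrN normrZ gtr0_norm//.
  suff : 0 <= r - yb w + a * `|w|.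
    by move=> /(mulr_ge0 (ltW t0)); congr (_ <= _); ring.
  have := fmin (x + w); rewrite (addrC x w) addrK hE (addrC w) => fxw.
  have := le_trans fxw (leeD2r _ wr).
  by rewrite -!EFinD lee_fin /=; lra.
have [y [yp yK]] := hahn_banach_cone sp cK pK.
(* The bound [y <= p] is used at both [v] and [- v]. *)
have yyb v : `|y v - yb v| <= a * `|v|.
  rewrite ler_norml; apply/andP; split; last by have := yp v; rewrite /p; lra.
  have := yp (- v); rewrite /p !linearN normrN /=; lra.
have yM v : `|y v| <= (a + dual_norm yb) * `|v|.
  have := yyb v; have := dual_norm_bound yb v.
  by have := ler_normD (y v - yb v) (yb v); rewrite subrK; lra.
have [y' y'E] := dual_of_bounded_linear yM.
exists y'.
  split=> [|u]; first by rewrite hE ltry.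
  (* [fmin] excludes [f u = -oo]. For finite [f u], the epigraph point [(u - x, f u - f x)] gives
     the subgradient inequality. *)
  rewrite y'E hE -EFinD; have [fu|] := boolP (f u \is a fin_num); last first.
    have := fmin u; rewrite hE; case: (f u) => // _ _; exact: leey.
  rewrite -(fineK fu) lee_fin.
  have := yK (u - x, fine (f u) - h) => /(_ _)/=.
  rewrite -lerBrDl; apply; exists (1, (u - x, fine (f u) - h)).
    split=> //; rewrite /epi/= (addrC x) subrK (addrC h) subrK.
    by rewrite fineK.
  by rewrite /= scale1r mul1r.
apply: dual_norm_le => v v1.
rewrite dual_addE dual_oppE y'E; apply: le_trans (yyb v) _.
by rewrite -[leRHS]mulr1 ler_wpM2l.
Qed.

End subgradient.

(** * Subregularity implies quadratic growth *)

Lemma subregular_quadratic_growth (R : realType) (X : completeNormedModType R)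
    (f : X -> \bar R) (xb : X) (yb : dual X) :
  Gamma f -> strongly_subregular (subdifferential f) xb yb ->
  exists U (c : R), [/\ nbhs xb U, 0 < c &
    forall x, U x ->
      (f xb + (yb (x - xb))%:E + (c * `|x - xb| ^+ 2)%:E <= f x)%E].
Proof.
move=> [fNy _ lf cf] [[fxb fyb] [kappa [k0 [U [V [xbU ybV subreg]]]]]].
have fxbfin : f xb \is a fin_num by rewrite fin_numE fNy lt_eqF.
pose h := fine (f xb); have hE : f xb = h%:E by rewrite fineK.
have [d /= d0 dU] := (nbhs_ballP _ _).1 xbU.
have [e /= e0 eV] := (nbhs_ballP _ _).1 ybV.
have [c c0 kc] : exists2 c, 0 < c & kappa * c = 8^-1.
  exists (8 * kappa)^-1; first by rewrite invr_gt0 mulr_gt0.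
  by rewrite invfM mulrCA divff ?mulr1// gt_eqF.
(* [r < d / 2] keeps [x], at distance below [3 r / 2] from [xb], in [U]; [r < e / (2 c)] keeps [y],
   within [2 c r] of [yb], in [V]. *)
exists (ball xb (Num.min (d / 2) (e / (2 * c)))), c; split=> //.
  by apply: nbhsx_ballx; rewrite lt_min !divr_gt0// mulr_gt0.
move=> z; rewrite -ball_normE /ball_/= distrC lt_min => /andP[zd ze].
have [->|zxb] := eqVneq z xb.
  by rewrite subrr linear0 normr0 expr0n/= mulr0 !adde0.
set r := `|z - xb| in zd ze *.
have r0 : 0 < r by rewrite normr_gt0 subr_eq0.
rewrite leNgt; apply/negP => fz.
pose g (u : X) := (f u + (- yb (u - xb))%:E)%E.
have gz : (g z < (h + c * r ^+ 2)%:E)%E.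
  move: fz; rewrite /g hE; case: (f z) (fNy z) => // s _.
  by rewrite -!EFinD !lte_fin; lra.
have gxb u : (h%:E <= g u)%E.
  have := fyb u; rewrite /g hE; case: (f u) => [s||]//=; last by move=> _; exact: leey.
  by rewrite -!EFinD !lee_fin; lra.
have cg : continuous (fun v : X => - yb (v - xb) : R).
  move=> v; apply: (@cvgN R R^o); apply: (cvg_comp (fun w => w - xb) yb).
    by apply: cvgB; [exact: cvg_id|exact: cvg_cst].
  exact: dual_continuous.
have lg : lower_semicontinuous g by exact: lower_semicontinuousD.
have a0 : 0 < 2 * c * r by rewrite !mulr_gt0.
have [x [xz xmin]] := ekeland a0 lg gxb (lt_trans gz (ltry _)).
(* Since [g >= h], [2 c r |x - z| <= g z - g x < c r ^ 2]. *)
have xzr : `|x - z| < r / 2.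
  have := le_lt_trans xz gz => /(le_lt_trans (leeD2r _ (gxb x))).
  rewrite -EFinD lte_fin ltrD2l => xz'.
  rewrite -(ltr_pM2l a0); apply: lt_le_trans xz' _.
  by rewrite le_eqVlt; apply/orP; left; apply/eqP; field.
have fxfin : f x \is a fin_num.
  have := le_lt_trans xz gz; rewrite /g fin_numE fNy/=.
  by case: (f x).
have [y fy yyb] : exists2 y : dual X, subdifferential f x y & `|y - yb| <= 2 * c * r.
  apply: perturbed_minimum_subgradient => //; first exact: ltW.
  move=> u; have := xmin u; rewrite /g -(fineK fxfin).
  case: (f u) (fNy u) => [s||]// _; last by move=> _; exact: leey.
  rewrite -!EFinD !lee_fin.
  have -> : u - x = (u - xb) - (x - xb) by rewrite opprB addrA subrK.
  by rewrite linearB /=; lra.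
have rx : r / 2 < `|x - xb|.
  by have := ler_distD x z xb; rewrite -/r (distrC z); lra.
have Ux : U x.
  apply: dU; rewrite -ball_normE /ball_/= distrC.
  by have := ler_distD z x xb; rewrite -/r; lra.
have Vy : V y.
  apply: eV; rewrite -ball_normE /ball_/= distrC; apply: le_lt_trans yyb _.
  by move: ze; rewrite ltr_pdivlMr ?mulr_gt0// mulrC.
have := subreg x Ux; apply/negP; rewrite -ltNge.
apply: le_lt_trans (lee_wpmul2l _ (ereal_inf_lbound _)) _.
- by rewrite lee_fin ltW.
- by exists y; [split|reflexivity].
rewrite -EFinM lte_fin distrC.
apply: le_lt_trans (ler_wpM2l (ltW k0) yyb) _.
have -> : kappa * (2 * c * r) = kappa * c * (2 * r) by ring.
by rewrite kc; lra.
Qed.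

(** * The cycle of implications *)

Theorem theorem3p6 (R : realType) (X : completeNormedModType R)
    (f : X -> \bar R) (xb : X) (yb : dual X) :
  Gamma f -> subdifferential f xb yb ->
  [<-> (* i *) strongly_subregular (subdifferential f) xb yb;
       (* ii *) exists U (c : R), [/\ nbhs xb U, 0 < c &
         forall x, U x ->
           (f xb + (yb (x - xb))%:E + (c * `|x - xb| ^+ 2)%:E <= f x)%E];
       (* iii *) exists U (c : R), [/\ nbhs xb U, 0 < c &
         forall x y, U x -> subdifferential f x y ->
           c * `|x - xb| ^+ 2 <= (y - yb) (x - xb)];
       (* iv *) strongly_monotonically_related (subdifferential f) xb yb].
Proof.
move=> Gf fyb; have [fNy _ _ _] := Gf.
split; first exact: subregular_quadratic_growth.
split.
  (* Adding the growth at [x] to the subgradient inequality of [y] at [xb] cancels the values of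
     [f]. *)
  move=> [U [c [xbU c0 growth]]]; exists U, c; split=> // x y Ux [fx fy].
  have fxfin : f x \is a fin_num by rewrite fin_numE fNy lt_eqF.
  have fxbfin : f xb \is a fin_num by rewrite fin_numE fNy lt_eqF//; case: fyb.
  have := fy xb; have := growth x Ux; rewrite -(fineK fxfin) -(fineK fxbfin).
  rewrite -!EFinD !lee_fin dual_addE dual_oppE -(opprB x) linearN /=; lra.
split.
  move=> [U [c [xbU c0 mono]]]; split=> //; exists U, setT; split=> //.
    exact: filterT.
  by exists c; split=> // x y [fxy [/= Ux _]]; exact: mono.
(* Bounding the pairing by [|y - yb| |x - xb|] and dividing by [|x - xb|] gives subregularity with
   [kappa = 1 / c]. *)
move=> [_ [U [V [xbU ybV [c [c0 mono]]]]]]; split=> //.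
exists c^-1; rewrite invr_gt0; split=> //; exists U, V; split=> // x Ux.
rewrite -lee_pdivrMl ?invr_gt0// invrK.
apply: le_ereal_inf_tmp => _ [y [fxy Vy] <-].
rewrite -EFinM lee_fin; have [->|xxb] := eqVneq x xb.
  by rewrite subrr normr0 mulr0.
have nx : 0 < `|x - xb| by rewrite normr_gt0 subr_eq0.
rewrite -(ler_pM2r nx) -mulrA -expr2 (distrC yb).
apply: le_trans (mono x y _) _; first by split.
exact: le_trans (ler_norm _) (dual_norm_bound (y - yb) (x - xb)).
Qed.
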